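(* Let $\Delta t>0$ and consider the CN-SM scheme $$\frac{u^{n+1}-u^{n}}{\Delta t}+\mathcal{A}\frac{u^{n+1}+u^{n}}{2}+g\left(\eta^{n+\frac12}\overline{u}^{n+\frac12}\right)=0,$$ $$\frac{\arctan V^{n+\frac12}-\arctan V^{n-\frac12}}{\Delta t}=-\frac{\mathcal{K}(u^n)}{E_{tot}^2(u^n)+1},\qquad \eta^{n+\frac12}=\chi(V^{n+\frac12}).$$ The scheme satisfies the energy inequality $$V^{n+\frac12}-V^{n-\frac12}\leq0.$$
   Context: The dissipative system is $\frac{\partial u}{\partial t}+\mathcal{A}u+g(u)=0$, where $u$ is a scalar or vector function, $\mathcal{A}$ is a positive definite operator and $g$ is a semi-linear or quasi-linear operator with lower-order derivatives. It satisfies the energy law $\frac{dE_{tot}(u)}{dt}=-\mathcal{K}(u)$, where $E_{tot}$ is a real-valued free energy (no lower bound on $E_{tot}$ is assumed) and $\mathcal{K}(u)\ge 0$ for all $u$. The auxiliary variable is $V(t)=E_{tot}(u(t))$; it is discretized on the staggered time mesh $t^{n\pm\frac12}$, where $t^n=n\Delta t$, so that $u^n$ approximates $u(t^n)$ and the real number $V^{n+\frac12}$ approximates $V(t^{n+\frac12})$. Here $\overline{u}^{n+\frac12}$ is any explicit $O(\Delta t^2)$ approximation of $u(t^{n+\frac12})$, and $\chi$ is a functional of $V$ that equals $1$ at the continuous level. The function $\arctan$ is the principal branch with values in $(-\pi/2,\pi/2)$. *)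

(* Defs.v *)
From mathcomp Require Import all_boot all_order all_algebra.
From mathcomp Require Import all_classical all_reals all_analysis.

Set Implicit Arguments.
Unset Strict Implicit.
Unset Printing Implicit Defensive.

Import Order.TTheory GRing.Theory Num.Theory.
Import numFieldNormedType.Exports.
Local Open Scope classical_set_scope.
Local Open Scope ring_scope.

Section Dissipative.
Context {R : realType} {H : normedModType R}.

(* The states u (scalar or vector functions) are elements of an inner product
   space H such as L^2; differential operators are only defined on part of H,
   so A and g come with domains and are irrelevant outside them. *)

Definition linear_on (D : {pred H}) (A : H -> H) : Prop :=
  forall a x y, x \in D -> y \in D -> A (a *: x + y) = a *: A x + A y.

Definition positive_definite_on (dot : H -> H -> R) (D : {pred H})
    (A : H -> H) : Prop :=
  forall x, x \in D -> x != 0 -> 0 < dot (A x) x.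

(* Classical solution on ]a, b[, twice continuously differentiable in time, of
   u_t + A u + g(u) = 0. *)
Definition smooth_solution (D : {pred H}) (A g : H -> H) (a b : R)
    (w : R -> H) : Prop :=
  forall t, t \in `]a, b[ ->
    [/\ w t \in D,
        derivable w t 1, derivable (derive1 w) t 1, {for t, continuous (derive1n 2 w)} &
        derive1 w t + A (w t) + g (w t) = 0].

(* [dom_A \subset dom_g] expresses that g only involves derivatives of lower
   order than A; the energy is not assumed to be bounded below. *)
Record dissipative_system (dot : H -> H -> R) := DissipativeSystem {
  dom_A : {pred H};
  dom_g : {pred H};
  opA : H -> H;
  opg : H -> H;
  Etot : H -> R;
  diss : H -> R;
  dom_A_submod : submod_closed dom_A;
  dom_A_sub_g : {subset dom_A <= dom_g};
  opA_linear : linear_on dom_A opA;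
  opA_posdef : positive_definite_on dot dom_A opA;
  diss_ge0 : forall x, x \in dom_A -> 0 <= diss x;
  energy_law : forall a b w, smooth_solution dom_A opA opg a b w ->
    forall t, t \in `]a, b[ -> is_derive t 1 (Etot \o w) (- diss (w t))
}.

Variables (dot : H -> H -> R) (S : dissipative_system dot).

Definition solution_of := smooth_solution (dom_A S) (opA S) (opg S).

(* [ext dt n u] is the approximation of u(t^{n+1/2}), where t^n = n dt, built
   from u^0, ..., u^n.  The O(dt^2) accuracy is the consistency error: the error
   made when the rule is fed with the grid values of a smooth solution.  The
   system being autonomous, taking a < 0 just keeps the grid in the interior of
   the time interval. *)
Definition explicit_rule (ext : R -> nat -> (nat -> H) -> H) : Prop :=
  forall dt n (u v : nat -> H),
    (forall k, (k <= n)%N -> u k = v k) -> ext dt n u = ext dt n v.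

Definition second_order_rule (ext : R -> nat -> (nat -> H) -> H) : Prop :=
  forall a b T w, a < 0 -> 0 < T -> T < b -> solution_of a b w ->
    exists C : R, \forall dt \near 0^'+, forall n : nat,
      (n%:R + 2^-1) * dt <= T ->
      `|ext dt n (fun k => w (k%:R * dt)) - w ((n%:R + 2^-1) * dt)|
        <= C * dt ^+ 2.

(* chi may involve the state besides V, as in chi(V) = V / E_tot(u); a function
   of V alone is the case where the first argument is ignored.  At the
   continuous level V(t) = E_tot(u(t)). *)
Definition one_at_continuous_level (chi : H -> R -> R) : Prop :=
  forall a b w, solution_of a b w ->
    forall t, t \in `]a, b[ -> chi (w t) (Etot S (w t)) = 1.

(* Staggered mesh: [V n] stands for V^{n-1/2}, hence [V n.+1] for V^{n+1/2};
   [eta n] stands for eta^{n+1/2}. *)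
Definition cn_sm_step (ext : R -> nat -> (nat -> H) -> H) (chi : H -> R -> R)
    (dt : R) (u : nat -> H) (V eta : nat -> R) (n : nat) : Prop :=
  let ubar := ext dt n u in
  [/\ [/\ u n \in dom_A S, u n.+1 \in dom_A S & eta n *: ubar \in dom_g S],
      dt^-1 *: (u n.+1 - u n) + opA S (2^-1 *: (u n.+1 + u n))
        + opg S (eta n *: ubar) = 0,
      (atan (V n.+1) - atan (V n)) / dt
        = - (diss S (u n) / (Etot S (u n) ^+ 2 + 1)) &
      eta n = chi ubar (V n.+1)].

End Dissipative.

(* Main.v *)
Require Import Defs.
From mathcomp Require Import all_boot all_order all_algebra.
From mathcomp Require Import all_classical all_reals all_analysis.

Import Order.TTheory GRing.Theory Num.Theory.
Import numFieldNormedType.Exports.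
Local Open Scope classical_set_scope.
Local Open Scope ring_scope.

(** The discrete energy equation involves the unknown V only through the
    increment of its arctangent: this increment is - dt times the quotient of
    the dissipation at u^n, nonnegative because u^n lies in the domain of the
    operator, by E_tot(u^n)^2 + 1 > 0.  Hence arctan V does not increase over a
    step, whatever the sign of the energy, and neither does V: arctan is
    strictly increasing on the whole line, so it reflects the order ([lt_atan],
    made into an equivalence by [le_mono]). *)

Theorem theorem2p10 (R : realType) (H : normedModType R)
    (dot : {dot H for idfun})
    (hdot : forall x : H, `|x| ^+ 2 = dot x x)
    (S : dissipative_system dot)
    (ext : R -> nat -> (nat -> H) -> H)
    (hexplicit : explicit_rule ext)
    (hsecond : second_order_rule S ext)
    (chi : H -> R -> R)
    (hchi : one_at_continuous_level S chi)
    (dt : R) (hdt : 0 < dt)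
    (u : nat -> H) (V eta : nat -> R) :
  forall n : nat, cn_sm_step S ext chi dt u V eta n -> V n.+1 - V n <= 0.
Proof.
move=> n [[un_dom _ _] _ hV _].
rewrite subr_le0 -(le_mono (@lt_atan R)) -subr_le0.
rewrite -(pmulr_lle0 _ (_ : 0 < dt^-1)) ?invr_gt0// hV oppr_le0.
by rewrite divr_ge0 ?diss_ge0// addr_ge0 ?sqr_ge0.
Qed.
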